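(* The problem of social benefit maximization in the class of dynamic lead-time quotation policies, i.e. maximizing $S(n_0,D_{n_0})$ over all dynamic quotation strategies $(n_0,D_{n_0})$, has an optimal solution $(D^{S}_{n_S},n_S)$, where $$n_S=\max(\underline{n},\min(\tilde n_S,\overline{n})),\qquad D^{S}_{n_S}=(\tilde d^{S}_{0},\ldots,\tilde d^{S}_{n_S-1},\tilde d^{P}_{n_S}+\epsilon)\ \text{ for any } \epsilon>0,$$ and the maximum social benefit is equal to $$S^*=\lambda\sum_{n=0}^{n_S-1}q(n;n_S)\big(G_n(\tilde d^{S}_{n})+B_n(\tilde d^S_n)\big).$$
   Context: Parameters: $\lambda,\mu>0$ (arrival and service rates of an observable M/M/1 system), $\rho=\lambda/\mu$; service value $R$, entrance fee $p$, waiting cost rate $c>0$, compensation rate $l$, risk-aversion coefficient $r>0$, with $0\le p\le R$ and $0\le l\le c$. For each integer $n\ge 0$, $X_n\sim Gamma(n+1,\mu)$ has density $\mu^{n+1}x^ne^{-\mu x}/n!$ on $(0,\infty)$. A lead-time quote is $d\in[0,\infty]$; $d=\infty$ means no compensation, with $(x-\infty)^+=0$. Expected utility of a joining customer who finds $n$ customers and is quoted $d$: $$B_n(d)=E\left[\frac{1-e^{-r(R-p-cX_n+l(X_n-d)^+)}}{r}\right]\in[-\infty,\infty).$$ The customer joins iff $B_n(d)\ge 0$. Let $L_n(d)=E(X_n-d)^+$, and let $G_n(d)=p-lL_n(d)$ if $B_n(d)\ge0$, $G_n(d)=0$ if $B_n(d)<0$. Put $\underline n=\inf\{n\ge0:\lim_{d\to\infty}B_n(d)<0\}$,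 $\overline n=\inf\{n\ge0:B_n(0)<0\}$ (with $\inf\varnothing=\infty$), $q(n;n_0)=\rho^n/\sum_{k=0}^{n_0}\rho^k$ for $0\le n\le n_0$, and $\tilde d^P_n=\sup\{d\ge0:B_n(d)\ge0\}$ with $\sup\varnothing=-1$. For $n=0,1,\ldots,\overline n-1$, $\tilde d^S_n$ denotes the optimal lead-time that induces a customer to join in state $n$, i.e. the lead-time maximizing $G_n(d)+B_n(d)$ over $d\in[0,\tilde d^P_n]$. A dynamic quotation strategy is a pair $(n_0,D_{n_0})$ with $n_0$ an integer, $\underline n\le n_0\le\overline n$, and $D_{n_0}=(d_0,\ldots,d_{n_0})$ a vector of nonnegative quotes such that $B_n(d_n)\ge0$ for $n=0,\ldots,n_0-1$ and $B_{n_0}(d_{n_0})<0$ (so $n_0$ is the balking threshold). Its social benefit per unit time is $S(n_0,D_{n_0})=\lambda\sum_{n=0}^{n_0-1}q(n;n_0)(G_n(d_n)+B_n(d_n))$. Finally $\tilde n_S=\min\{n_0: Y(n_0)<0\}$ (with $\min\varnothing=\infty$), where, for $n_0$ such that $\tilde d^S_{n_0}$ is defined, $$Y(n_0)=(G_{n_0}+B_{n_0})(\tilde d^S_{n_0})\sum_{n=0}^{n_0}\rho^n-\rho\sum_{n=0}^{n_0-1}\rho^n(G_n+B_n)(\tilde d^S_n).$$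
   Formalization: Instead of any ε>0, ε ranges over those ε>0 with d̃^P_{n_S}+ε ≥ 0: when d̃^P_{n_S} = −1 (n_S = n̄, e.g. l = 0) and ε<1, the last quote would be negative, so the vector is not a dynamic quotation strategy. *)

(* Defs.v *)
From HB Require Import structures.
From mathcomp Require Import all_boot all_order all_algebra.
From mathcomp Require Import all_classical all_reals all_analysis.

Set Implicit Arguments.
Unset Strict Implicit.
Unset Printing Implicit Defensive.

Import Order.TTheory GRing.Theory Num.Theory.
Import numFieldNormedType.Exports.

Local Open Scope classical_set_scope.
Local Open Scope ring_scope.
Local Open Scope ereal_scope.

Record params (R : realType) := Params {
  arrival : R;
  service : R;
  value : R;
  fee : R;
  waiting : R;
  compensation : R;
  risk : R }.

Definition admissible_params (R : realType) (m : params R) : Prop :=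
  [/\ (0 < arrival m)%R, (0 < service m)%R, (0 < waiting m)%R & (0 < risk m)%R]
  /\ (0 <= fee m <= value m)%R
  /\ (0 <= compensation m <= waiting m)%R.

Definition gamma_pdf (R : realType) (n : nat) (rate : R) : R -> R :=
  (fun x => rate ^+ n.+1 * x ^+ n * expR (- (rate * x)) / n`!%:R)%R \_ `]0%R, +oo[.

Definition gamma_waiting d (T : measurableType d) (R : realType)
    (P : probability T R) (X : nat -> {RV P >-> R}) (m : params R) : Prop :=
  forall (n : nat) (A : set R), measurable A ->
    distribution P (X n) A =
      \int[lebesgue_measure]_(x in A) (gamma_pdf n (service m) x)%:E.

(* (x - q)^+ for a quote q in [0, +oo]; it is 0 for q = +oo since
   x%:E - +oo = -oo. *)
Definition excess (R : realType) (x : R) (q : \bar R) : R :=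
  fine (maxe (x%:E - q) 0).

Section Model.
Context d (T : measurableType d) (R : realType) (P : probability T R).
Variables (X : nat -> {RV P >-> R}) (m : params R).

Local Notation lam := (arrival m).
Local Notation p := (fee m).
Local Notation c := (waiting m).
Local Notation l := (compensation m).
Local Notation r := (risk m).
Local Notation rho := (arrival m / service m)%R.

(* The integrand is bounded above by 1/r, so the expectation is well defined
   in [-oo, +oo[; it is -oo when the exponential moment is infinite. *)
Definition B (n : nat) (q : \bar R) : \bar R :=
  'E_P[fun w =>
    ((1 - expR (- (r * (value m - p - c * X n w + l * excess (X n w) q)))) / r)%R].

Definition L (n : nat) (q : \bar R) : \bar R :=
  'E_P[fun w => excess (X n w) q].

Definition G (n : nat) (q : \bar R) : \bar R :=
  if 0 <= B n q then p%:E - l%:E * L n q else 0.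

(* Thresholds are extended reals, so that ereal_inf set0 = +oo renders
   the conventions inf(empty) = min(empty) = +oo. *)
Definition n_low : \bar R :=
  ereal_inf [set n%:R%:E | n in
    [set n : nat | lim (B n x%:E @[x --> +oo%R]) < 0]].

Definition n_high : \bar R :=
  ereal_inf [set n%:R%:E | n in [set n : nat | B n 0 < 0]].

Definition q_stat (n n0 : nat) : R := (rho ^+ n / \sum_(k < n0.+1) rho ^+ k)%R.

Definition acceptable (n : nat) : set (\bar R) :=
  [set q | 0 <= q /\ 0 <= B n q].

Definition dP (n : nat) : \bar R :=
  if `[< acceptable n !=set0 >] then ereal_sup (acceptable n) else (- 1)%:E.

Definition is_dS (n : nat) (q : \bar R) : Prop :=
  0 <= q <= dP n /\
  forall q', 0 <= q' <= dP n -> G n q' + B n q' <= G n q + B n q.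

(* The maximizer need not be unique (for instance when the compensation rate is
   0), so the quotes d^S are an arbitrary selection of maximizers. *)
Definition dS_selection (dS : nat -> \bar R) : Prop :=
  forall n : nat, n%:R%:E < n_high -> is_dS n (dS n).

Definition dynamic_strategy (n0 : nat) (D : 'I_n0.+1 -> \bar R) : Prop :=
  [/\ n_low <= n0%:R%:E <= n_high,
      forall i, 0 <= D i,
      forall i : 'I_n0.+1, (i < n0)%N -> 0 <= B i (D i)
    & B n0 (D ord_max) < 0].

Definition social_benefit (n0 : nat) (D : 'I_n0.+1 -> \bar R) : \bar R :=
  lam%:E * \sum_(i < n0.+1 | (i < n0)%N)
    (q_stat i n0)%:E * (G i (D i) + B i (D i)).

Definition social_optimal (n0 : nat) (D : 'I_n0.+1 -> \bar R) : Prop :=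
  dynamic_strategy D /\
  forall (n1 : nat) (D1 : 'I_n1.+1 -> \bar R),
    dynamic_strategy D1 -> social_benefit D1 <= social_benefit D.

Definition Y (dS : nat -> \bar R) (n0 : nat) : \bar R :=
  (G n0 (dS n0) + B n0 (dS n0)) * (\sum_(n < n0.+1) rho ^+ n)%:E
  - rho%:E * \sum_(n < n0) (rho ^+ n)%:E * (G n (dS n) + B n (dS n)).

(* Y dS n0 is meaningful only for n0 < n_high. *)
Definition n_tilde (dS : nat -> \bar R) : \bar R :=
  ereal_inf [set n%:R%:E | n in
    [set n : nat | n%:R%:E < n_high /\ Y dS n < 0]].

Definition D_S (dS : nat -> \bar R) (nS : nat) (eps : R) : 'I_nS.+1 -> \bar R :=
  fun i => if (i < nS)%N then dS i else dP nS + eps%:E.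

End Model.

(* Main.v *)
Require Import Defs.
From HB Require Import structures.
From mathcomp Require Import all_boot all_order all_algebra.

From mathcomp Require Import all_classical all_reals all_analysis.
From mathcomp Require Import measurable_realfun ring lra.

Import Order.TTheory GRing.Theory Num.Theory.
Import numFieldNormedType.Exports.

Local Open Scope classical_set_scope.
Local Open Scope ring_scope.
Local Open Scope ereal_scope.

Set Implicit Arguments.
Unset Strict Implicit.
Unset Printing Implicit Defensive.

(** For a fixed balking threshold the long-run benefit is a weighted sum over the
    states with weights that do not depend on the quotes, so each state should
    use the quote maximizing its own welfare, the expected sum of firm's net
    receipts and customer's utility. What remains is a one-dimensional problem in
    the threshold: with optimal welfare [f n] in state [n], raising the threshold
    from [n] to [n.+1] changes the mean reward by a positive multiple of the
    quantity [Y n] of the statement ([mean_reward_step]), and the increment of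
    [Y] is a positive multiple of [f n.+1 - f n] ([marginal_step]). Thus if [f]
    is nonincreasing, [Y] changes sign once, the mean reward is unimodal, and its
    maximum over the admissible range of thresholds is found by clipping.

    Monotonicity of [f] comes from stochastic order: Gamma waiting times increase
    with the state ([gamma_stochastic_order]), while both the utility and the
    receipts of the firm decrease with the waiting time, the compensation rate
    being at most the waiting cost rate. A quote acceptable in a state is then
    acceptable in the preceding one and yields more welfare there.

    Analytic care is needed since expected utilities may be [-oo]. Utilities are
    bounded above, so Fatou's lemma still gives upper semicontinuity in the quote;
    this shows that acceptable quotes form a closed segment
    ([acceptable_le_dP]) and that the limit in the definition of the lower
    threshold is negative exactly when the expected utility without compensation
    is ([lim_B_lt0]). On acceptable quotes everything is integrable. A maximizing
    quote exists ([exists_dS]) because welfare decreases once the quote passes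
    the point where the customer breaks even, which leaves a compact segment, on
    which welfare is continuous by dominated convergence.

    Finally the thresholds are finite: the utility is at most its argument, so
    welfare in state [n] is at most value minus expected waiting cost, which tends
    to minus infinity ([GB_le]). This bounds the lower threshold, and the stopping
    threshold even when customers can be made to join in every state. *)

(** * Integration of functions bounded above *)

(** The Radon-Nikodym derivative of [nu] is almost everywhere [phi], so the
    change of measure for the derivative gives the one for the density. *)
Lemma ge0_integral_density (d : measure_display) (T : measurableType d)
    (R : realType) (nu : {finite_measure set T -> \bar R})
    (mu : {sigma_finite_measure set T -> \bar R}) (phi : T -> R)
    (h : T -> \bar R) :
  (forall x, 0 <= phi x)%R -> measurable_fun [set: T] phi ->
  (forall A, measurable A -> nu A = \int[mu]_(x in A) (phi x)%:E) ->
  (forall x, 0 <= h x) -> measurable_fun [set: T] h ->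
  \int[nu]_x h x = \int[mu]_x (h x * (phi x)%:E).
Proof.
move=> phi0 mphi nuE h0 mh.
have mphiE : measurable_fun [set: T] (EFin \o phi) by exact/measurable_EFinP.
have numu : nu `<< mu.
  apply/null_content_dominatesP => A mA muA0; rewrite nuE//; apply: null_set_integral => //.
  exact: measurable_funTS.
rewrite -(Radon_Nikodym_SigmaFinite.change_of_variables numu)//.
set g := Radon_Nikodym_SigmaFinite.f _ _.
have ig : mu.-integrable setT g by exact: Radon_Nikodym_SigmaFinite.f_integrable.
apply: ae_eq_integral => //.
- by apply: emeasurable_funM => //; exact: (measurable_int mu ig).
- exact: emeasurable_funM.
- apply: ae_eqe_mul2l; apply: integral_ae_eq => //.
  by move=> E _ mE; rewrite -nuE// -Radon_Nikodym_SigmaFinite.f_integral.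
Qed.

Section BoundedAbove.
Context (d : measure_display) (T : measurableType d) (R : realType)
  (P : probability T R).

(** Utilities are bounded above but their expectation may be [-oo]; writing
    them as a constant minus a nonnegative function reduces everything about
    such integrals to integrals of nonnegative functions. *)
Lemma integral_bounded_above (a : R) (g : T -> R) :
  measurable_fun [set: T] g -> (forall x, g x <= a)%R ->
  \int[P]_x (g x)%:E = a%:E - \int[P]_x (a - g x)%:E.
Proof.
move=> mg ga.
have ia : P.-integrable setT (EFin \o cst a).
  exact: finite_measure_integrable_cst.
have Ea b : \int[P]_x (b%:E) = b%:E :> \bar R.
  by rewrite -[RHS](expectation_cst P) unlock.
have mh : measurable_fun [set: T] (fun x => (a - g x)%:E).
  by apply/measurable_EFinP; exact: measurable_funB.
have h0 x : 0 <= (a - g x)%:E by rewrite lee_fin subr_ge0.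
have [hoo|hoo] := eqVneq (\int[P]_x (a - g x)%:E) +oo; last first.
  have ih : P.-integrable setT (EFin \o (fun x => a - g x)%R).
    apply/integrableP; split => //.
    rewrite (eq_integral (fun x => (a - g x)%:E)); last first.
      by move=> x _; rewrite [LHS]gee0_abs//; exact: h0.
    by rewrite ltey; exact: hoo.
  rewrite -[X in _ = X - _](Ea a) -integralB_EFin//.
  by apply: eq_integral => x _; rewrite -EFinB opprB addrC subrK.
rewrite hoo addeNy.
have ig : ~ P.-integrable setT (EFin \o g).
  move=> ig; have /integrable_lty := integrableB measurableT ia ig.
  have -> : \int[P]_x ((EFin \o cst a) \- (EFin \o g)) x = +oo.
    by rewrite -hoo; apply: eq_integral.
  by move=> /(_ measurableT); rewrite ltxx.
rewrite integralE.
have -> : \int[P]_x (fun x => (g x)%:E)^\- x = +oo.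
  apply/eqP; apply/negPn/negP => goo.
  apply: ig; apply/integrableP; split; first exact/measurable_EFinP.
  have mgE : measurable_fun [set: T] (EFin \o g) by exact/measurable_EFinP.
  have -> : \int[P]_x `|(EFin \o g) x| =
      \int[P]_x ((EFin \o g)^\+ x + (EFin \o g)^\- x).
    by apply: eq_integral => x _;
    rewrite -[LHS]/((abse \o (EFin \o g)) x) fune_abse.
  rewrite ge0_integralD//; [|exact: measurable_funepos|exact: measurable_funeneg].
  apply: lte_add_pinfty; last by rewrite ltey; exact: goo.
  apply: (@le_lt_trans _ _ (\int[P]_x (`|a|%:E))).
    apply: ge0_le_integral => //.
    + exact: measurable_funepos.
    + move=> x _; rewrite funeposE -EFin_max lee_fin ge_max normr_ge0 andbT.
      exact: le_trans (ga x) (ler_norm _).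
  by rewrite Ea ltry.
by rewrite addeNy.
Qed.

Lemma le_integral_bounded_above (a : R) (g1 g2 : T -> R) :
  measurable_fun [set: T] g1 -> measurable_fun [set: T] g2 ->
  (forall x, g2 x <= a)%R -> (forall x, g1 x <= g2 x)%R ->
  \int[P]_x (g1 x)%:E <= \int[P]_x (g2 x)%:E.
Proof.
move=> mg1 mg2 ga g12.
rewrite (@integral_bounded_above a g1)//; last by move=> x; exact: le_trans (ga x).
rewrite (@integral_bounded_above a g2)// leeB//.
apply: ge0_le_integral => [//|x _|||x _].
- by rewrite lee_fin subr_ge0.
- by apply/measurable_EFinP; exact: measurable_funB.
- by apply/measurable_EFinP; exact: measurable_funB.
- by rewrite lee_fin lerB.
Qed.

(** The reverse Fatou lemma for a common upper bound, used as a closedness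
    statement: nonnegativity of the expectations survives a pointwise limit.
    Domination from below is not available here, since the exponential moment
    of the limit may be infinite. *)
Lemma integral_ge0_limit (a : R) (g_ : nat -> T -> R) (g : T -> R) :
  (forall k, measurable_fun [set: T] (g_ k)) -> measurable_fun [set: T] g ->
  (forall k x, g_ k x <= a)%R -> (forall x, g x <= a)%R ->
  (forall x, (g_ k x)%:E @[k --> \oo] --> (g x)%:E) ->
  (forall k, 0 <= \int[P]_x (g_ k x)%:E) -> 0 <= \int[P]_x (g x)%:E.
Proof.
move=> mg_ mg g_a ga g_g g_0.
have lim_g x : limn_einf (fun k => (a - g_ k x)%:E) = (a - g x)%:E.
  have cv : (a - g_ k x)%:E @[k --> \oo] --> (a - g x)%:E.
    rewrite EFinB; under eq_fun do rewrite EFinB.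
    by apply: cvgeB => //; exact: cvg_cst.
  by have [-> _] := cvg_limn_einf_sup cv.
have fat : \int[P]_x (a - g x)%:E <= a%:E.
  have := @fatou _ _ _ P setT measurableT (fun k x => (a - g_ k x)%:E).
  under eq_integral do rewrite lim_g.
  move=> /(_ _ _)/le_trans.
  apply.
  - by move=> k; apply/measurable_EFinP; exact: measurable_funB.
  - by move=> k x _; rewrite lee_fin subr_ge0.
  - rewrite limn_einf_lim; apply: lime_le; first exact: is_cvg_einfs.
    apply: nearW => k.
    apply: (@le_trans _ _ (\int[P]_x (a - g_ k x)%:E)).
      by apply: ereal_inf_lbound; exists k => /=.
    have := g_0 k; rewrite (@integral_bounded_above a (g_ k))//.
    by rewrite sube_ge0 ?orbT.
rewrite (@integral_bounded_above a)//.
by rewrite sube_ge0 ?orbT.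
Qed.
Lemma integrable_bounded_above (a : R) (g : T -> R) :
  measurable_fun [set: T] g -> (forall x, g x <= a)%R ->
  0 <= \int[P]_x (g x)%:E -> P.-integrable [set: T] (EFin \o g).
Proof.
move=> mg ga; rewrite (@integral_bounded_above a g)//.
rewrite sube_ge0 ?orbT// => hle.
have mh : measurable_fun [set: T] (fun x => (a - g x)%R).
  exact: measurable_funB.
have ih : P.-integrable [set: T] (EFin \o (fun x => a - g x)%R).
  apply/integrableP; split; first exact/measurable_EFinP.
  under eq_integral => x _ do rewrite gee0_abs ?lee_fin ?subr_ge0//.
  by rewrite (le_lt_trans hle)// ltry.
have ia : P.-integrable [set: T] (EFin \o cst a).
  exact: finite_measure_integrable_cst.
rewrite (_ : EFin \o g = (EFin \o cst a) \- (EFin \o (fun x => a - g x)%R)).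
  exact: integrableB.
by apply/funext => x /=; rewrite -EFinB opprB addrC subrK.
Qed.

End BoundedAbove.

(** * Compensation, utility and the Gamma law *)

Section Excess.
Context {R : realType}.
Implicit Types (x y : R) (q : \bar R).

Lemma excess_EFin x y : excess x y%:E = Num.max (x - y)%R 0%R.
Proof. by rewrite /excess -EFinB -EFin_max. Qed.

Lemma excess_pinfty x : excess x +oo = 0%R.
Proof. by rewrite /excess addeNy maxNye. Qed.

Lemma excess_ge0 x q : 0 <= q -> (0 <= excess x q)%R.
Proof.
case: q => [y _||//]; rewrite ?excess_pinfty// excess_EFin.
by rewrite le_max lexx orbT.
Qed.

Lemma excess_le_norm x q : 0 <= q -> (excess x q <= `|x|)%R.
Proof.
case: q => [y|_|//]; rewrite ?excess_pinfty// excess_EFin lee_fin => y0.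
rewrite ge_max normr_ge0 andbT.
by rewrite (le_trans _ (ler_norm x))// lerBlDr lerDl.
Qed.

Lemma le_excess x q q' : 0 <= q -> q <= q' -> (excess x q' <= excess x q)%R.
Proof.
move=> q0; case: q' => [y'||].
- case: q q0 => [y||//] y0; last by rewrite leye_eq.
  by rewrite !excess_EFin lee_fin => yy'; rewrite ge_max !le_max lexx orbT lerB.
- by rewrite excess_pinfty excess_ge0.
- by move/(le_trans q0).
Qed.

Lemma excess_homo x y q : 0 <= q -> (x <= y)%R -> (excess x q <= excess y q)%R.
Proof.
case: q => [z _ xy||//]; last by rewrite !excess_pinfty.
by rewrite !excess_EFin ge_max !le_max lexx orbT lerB.
Qed.

Lemma excess_lipschitz x y q : 0 <= q -> (x <= y)%R ->
  (excess y q - excess x q <= y - x)%R.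
Proof.
case: q => [z _ xy|_ xy|//]; last by rewrite !excess_pinfty subr0 subr_ge0.
by rewrite !excess_EFin; case: (leP (y - z) 0)%R; case: (leP (x - z) 0)%R; lra.
Qed.

Lemma measurable_excess q : 0 <= q -> measurable_fun [set: R] (fun x : R => excess x q).
Proof.
case: q => [z _|_|//]; last first.
  rewrite (_ : (fun x : R => _) = cst 0%R)//.
  by apply/funext => x; rewrite excess_pinfty.
rewrite (_ : (fun x : R => _) = (fun x => x - z)%R \max cst 0%R).
  by apply: measurable_maxr => //; exact: measurable_funB.
by apply/funext => x; rewrite excess_EFin.
Qed.

End Excess.

Section Utility.
Context {R : realType} (m : params R).
Implicit Types (x y : R) (q : \bar R).

Definition utility y : R := ((1 - expR (- (risk m * y))) / risk m)%R.

Definition net_value q x : R :=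
  (value m - fee m - waiting m * x + compensation m * excess x q)%R.

Hypothesis hm : admissible_params m.

Let r0 : (0 < risk m)%R. Proof. by case: hm => [[]]. Qed.
Let c0 : (0 < waiting m)%R. Proof. by case: hm => [[]]. Qed.
Let l0 : (0 <= compensation m)%R. Proof. by case: hm => _ [_ /andP[]]. Qed.
Let lc : (compensation m <= waiting m)%R. Proof. by case: hm => _ [_ /andP[]]. Qed.

Lemma utility_homo : {homo utility : x y / (x <= y)%R}.
Proof.
move=> x y xy; rewrite /utility ler_pM2r ?invr_gt0// lerB// ler_expR lerN2.
by rewrite ler_pM2l.
Qed.

Lemma utility_le_bound y : (utility y <= (risk m)^-1)%R.
Proof.
by rewrite /utility ler_pdivrMr// mulVf ?gt_eqF// gerBl expR_ge0.
Qed.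

(** Risk aversion: the utility is concave with slope 1 at the origin, hence lies
    below its tangent. Linear bounds on expected utility follow without any
    exponential moment. *)
Lemma utility_le_id y : (utility y <= y)%R.
Proof.
rewrite /utility ler_pdivrMr//.
have := expR_ge1Dx (- (risk m * y)); lra.
Qed.

(** On losses the marginal utility is at least 1, so a unit of money is worth at
    least as much to the customer as to the firm. *)
Lemma utility_slope x y : (x <= y)%R -> (y <= 0)%R ->
  (y - x <= utility y - utility x)%R.
Proof.
move=> xy y0; rewrite /utility -mulrBl ler_pdivlMr//.
have := r0; set r := risk m => r_gt0.
have -> : (- (r * x) = - (r * y) + r * (y - x))%R by ring.
rewrite expRD.
have ey : (1 <= expR (- (r * y)))%R.
  by rewrite -expR0 ler_expR oppr_ge0 pmulr_rle0.
have ed := expR_ge1Dx (r * (y - x)).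
have d0 : (0 <= r * (y - x))%R by rewrite mulr_ge0 ?subr_ge0// ltW.
nra.
Qed.

(** Compensation grows at rate at most [compensation m <= waiting m], so it never
    outpaces the cost of waiting. *)
Lemma net_value_nonincr q : 0 <= q ->
  {homo net_value q : x y / (x <= y)%R >-> (y <= x)%R}.
Proof.
move=> q0 x y xy; rewrite /net_value.
have exy := excess_homo q0 xy.
have : (compensation m * (excess y q - excess x q) <= waiting m * (y - x))%R.
  by rewrite ler_pM ?subr_ge0// excess_lipschitz.
lra.
Qed.

Lemma net_value_le q q' x : 0 <= q -> q <= q' ->
  (net_value q' x <= net_value q x)%R.
Proof.
by move=> q0 qq'; rewrite /net_value lerD2l ler_wpM2l// le_excess.
Qed.

Lemma measurable_utility : measurable_fun [set: R] utility.
Proof.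
apply: measurable_funM => //; apply: measurable_funB => //.
apply: measurableT_comp => //; apply: measurableT_comp => //.
Qed.

Lemma measurable_net_value q : 0 <= q -> measurable_fun [set: R] (net_value q).
Proof.
move=> q0; apply: measurable_funD.
  by apply: measurable_funB => //; exact: measurable_funM.
by apply: measurable_funM => //; exact: measurable_excess.
Qed.

End Utility.

Section Gamma.
Context (d : measure_display) (T : measurableType d) (R : realType)
  (P : probability T R) (X : nat -> {RV P >-> R}) (m : params R).
Hypotheses (hm : admissible_params m) (hX : gamma_waiting X m).

Let mu0 : (0 < service m)%R. Proof. by case: hm => [[]]. Qed.

Lemma gamma_pdf_ge0 n x : (0 <= gamma_pdf n (service m) x)%R.
Proof.
rewrite /gamma_pdf patchE; case: ifPn => // /set_mem/=; rewrite in_itv/= andbT => x0.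
by rewrite divr_ge0// !mulr_ge0 ?expR_ge0 ?exprn_ge0 ?ltW.
Qed.

Lemma measurable_gamma_pdf n : measurable_fun [set: R] (gamma_pdf n (service m)).
Proof.
apply/(measurable_restrictT _ _).1 => //.
apply: measurable_funM => //; apply: measurable_funM.
  by apply: measurable_funM => //; exact: exprn_measurable.
apply: measurable_funTS; apply: measurableT_comp => //.
apply: measurableT_comp => //; exact: measurable_funM.
Qed.

(** Size-biasing a Gamma density yields the next one. This gives both the means
    and the likelihood ratio of two consecutive densities, which is linear in
    [x] and therefore crosses 1 exactly once, at [n.+1 / service m]. *)
Lemma gamma_pdfS n x :
  (gamma_pdf n.+1 (service m) x * (n.+1%:R / service m) =
   x * gamma_pdf n (service m) x)%R.
Proof.
rewrite /gamma_pdf !patchE; case: ifPn => _; last by rewrite mul0r mulr0.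
rewrite factS natrM exprS [(x ^+ n.+1)%R]exprS.
field.
by rewrite !pnatr_eq0 -lt0n fact_gt0 gt_eqF// nat1r pnatr_eq0.
Qed.

(** Expectations of functions of the waiting time as integrals against the Gamma
    density; nonnegativity of [h] allows infinite values. *)
Lemma expectation_gamma n (h : R -> R) :
  measurable_fun [set: R] h -> (forall x, 0 <= h x)%R ->
  \int[P]_w (h (X n w))%:E =
  \int[lebesgue_measure]_x (h x * gamma_pdf n (service m) x)%:E.
Proof.
move=> mh h0.
(* Lebesgue measure lives on the sigma-algebra generated by intervals, whose
   display differs from the default one on [R]; [X'] is [X n] retyped there. *)
have mX : measurable_fun [set: T] (X n : T -> measurableTypeR R).
  by have := @measurable_funP _ _ _ _ setT (X n).
pose X' : {mfun T >-> measurableTypeR R} :=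
  HB.pack (X n : T -> measurableTypeR R) (isMeasurableFun.Build _ _ _ _ _ mX).
have mhE : measurable_fun [set: measurableTypeR R] (EFin \o h).
  exact/measurable_EFinP.
rewrite -(ge0_integral_distribution X' mhE); last by move=> x; rewrite lee_fin.
rewrite (@ge0_integral_density _ _ _ (distribution P X') lebesgue_measure
  (gamma_pdf n (service m)))//.
- by move=> x; exact: gamma_pdf_ge0.
- exact: measurable_gamma_pdf.
- by move=> A mA; have := hX n (mA : @measurable default_measure_display R A); apply.
Qed.

Lemma integral_gamma_pdf n :
  \int[lebesgue_measure]_x (gamma_pdf n (service m) x)%:E = 1.
Proof.
have /= E1 : \int[P]_w 1%:E = _ :=
  @expectation_gamma n (fun=> 1%R) (measurable_cst _) (fun=> ler01).
rewrite -(expectation_cst P 1%R) unlock E1.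
by apply: eq_integral => x _; rewrite mul1r.
Qed.

Let measurable_gamma_pdfM n (h : R -> R) : measurable_fun [set: R] h ->
  measurable_fun [set: measurableTypeR R]
    (fun x => (h x * gamma_pdf n (service m) x)%:E).
Proof.
move=> mh; apply/measurable_EFinP; apply: measurable_funM => //.
exact: measurable_gamma_pdf.
Qed.

(** Single crossing: to the left of [x0] the density of index [n] dominates and
    [h] is at most [h x0], to the right both comparisons are reversed. Hence
    [(h x - h x0) * (g x - f x)] is nonnegative everywhere, and integrating it
    gives the claim because both densities have mass 1. The terms are kept
    additive so that only nonnegative, possibly infinite, integrals occur. *)
Lemma gamma_stochastic_order n (h : R -> R) :
  measurable_fun [set: R] h -> (forall x, 0 <= h x)%R ->
  {homo h : x y / (x <= y)%R} ->
  \int[P]_w (h (X n w))%:E <= \int[P]_w (h (X n.+1 w))%:E.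
Proof.
move=> mh h0 hh; rewrite !(@expectation_gamma _ h)//.
set x0 := (n.+1%:R / service m)%R.
have x00 : (0 < x0)%R by rewrite divr_gt0.
set f := gamma_pdf n (service m); set g := gamma_pdf n.+1 (service m).
have f0 x : (0 <= f x)%R by exact: gamma_pdf_ge0.
have g0 x : (0 <= g x)%R by exact: gamma_pdf_ge0.
have cross x : (h x * f x + h x0 * g x <= h x * g x + h x0 * f x)%R.
  have gfx : (g x * x0 = x * f x)%R by exact: gamma_pdfS.
  have [xx0|/ltW x0x] := leP x x0.
    have gf : (g x <= f x)%R.
      by rewrite -(ler_pM2r x00) gfx (mulrC (f x)) ler_wpM2r.
    have := hh _ _ xx0; nra.
  have fg : (f x <= g x)%R.
    by rewrite -(ler_pM2r x00) gfx (mulrC (f x)) ler_wpM2r.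
  have := hh _ _ x0x; nra.
have pdf_cst k : \int[lebesgue_measure]_x
    (h x0 * gamma_pdf k (service m) x)%:E = (h x0)%:E.
  under eq_integral do rewrite EFinM.
  rewrite ge0_integralZl ?integral_gamma_pdf ?mule1 ?lee_fin//.
  - by apply/measurable_EFinP; exact: measurable_gamma_pdf.
  - by move=> x _; rewrite lee_fin gamma_pdf_ge0.
have mcst k : measurable_fun [set: measurableTypeR R]
    (fun x => (h x0 * gamma_pdf k (service m) x)%:E).
  exact: (@measurable_gamma_pdfM k (cst (h x0))).
have addE k j : \int[lebesgue_measure]_x
      (h x * gamma_pdf k (service m) x)%:E + (h x0)%:E =
    \int[lebesgue_measure]_x
      (h x * gamma_pdf k (service m) x + h x0 * gamma_pdf j (service m) x)%:E.
  under [RHS]eq_integral do rewrite EFinD.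
  rewrite ge0_integralD ?pdf_cst//; try first
    [ exact: mcst | exact: measurable_gamma_pdfM
    | by move=> x _; rewrite lee_fin mulr_ge0// gamma_pdf_ge0 ].
rewrite -(@leeD2rE _ (h x0)%:E)// (addE n n.+1) (addE n.+1 n).
apply: ge0_le_integral => [//|x _|||x _].
- by rewrite lee_fin addr_ge0 ?mulr_ge0.
- by under eq_fun do rewrite EFinD; apply: emeasurable_funD => //;
    exact: measurable_gamma_pdfM.
- by under eq_fun do rewrite EFinD; apply: emeasurable_funD => //;
    exact: measurable_gamma_pdfM.
- by rewrite lee_fin cross.
Qed.

(** Decreasing functions of the waiting time that are bounded above: the form in
    which stochastic order is applied to utilities. *)
Lemma gamma_stochastic_order_le n (a : R) (g : R -> R) :
  measurable_fun [set: R] g -> (forall x, g x <= a)%R ->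
  {homo g : x y / (x <= y)%R >-> (y <= x)%R} ->
  \int[P]_w (g (X n.+1 w))%:E <= \int[P]_w (g (X n w))%:E.
Proof.
move=> mg ga hg.
have mgX k : measurable_fun [set: T] (fun w => g (X k w)).
  exact: measurableT_comp.
rewrite !(@integral_bounded_above _ _ _ _ a (fun w => g (X _ w)))// leeB//.
apply: (@gamma_stochastic_order n (fun x => a - g x)%R).
- exact: measurable_funB.
- by move=> x; rewrite subr_ge0.
- by move=> x y xy; rewrite lerB// hg.
Qed.

(** The absolute value is there because a Gamma variable is nonnegative only
    almost surely; this form yields integrability. *)
Lemma gamma_abs_mean n :
  \int[P]_w `|X n w|%:E = (n.+1%:R / service m)%:E.
Proof.
rewrite (@expectation_gamma n Num.norm)//.
transitivity (\int[lebesgue_measure]_x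
    ((n.+1%:R / service m)%:E * (gamma_pdf n.+1 (service m) x)%:E)).
  apply: eq_integral => x _; rewrite -EFinM mulrC.
  rewrite [in RHS]mulrC gamma_pdfS mulrC; congr EFin.
  rewrite /gamma_pdf patchE; case: ifPn => [|_]; last by rewrite !mulr0.
  by rewrite inE/= in_itv/= andbT => x0; rewrite gtr0_norm.
rewrite ge0_integralZl// ?integral_gamma_pdf ?mule1//.
- by apply/measurable_EFinP; exact: measurable_gamma_pdf.
- by move=> x _; rewrite lee_fin gamma_pdf_ge0.
- by rewrite lee_fin divr_ge0// ltW.
Qed.

Lemma integrable_gamma n : P.-integrable [set: T] (EFin \o X n).
Proof.
apply/integrableP; split; first exact/measurable_EFinP.
by under eq_integral do rewrite abse_EFin; rewrite gamma_abs_mean ltry.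
Qed.

Lemma gamma_mean n : \int[P]_w (X n w)%:E = (n.+1%:R / service m)%:E.
Proof.
have iX := integrable_gamma n.
have iNX : P.-integrable [set: T] (EFin \o (fun w => `|X n w|%R)).
  exact: integrable_norm.
have : \int[P]_w (`|X n w| - X n w)%:E = 0.
  rewrite (@expectation_gamma n (fun x => `|x| - x)%R); last 2 first.
  - exact: measurable_funB.
  - by move=> x; rewrite subr_ge0 ler_norm.
  rewrite integral0_eq// => x _; rewrite /gamma_pdf patchE.
  case: ifPn => [|_]; last by rewrite mulr0.
  by rewrite inE/= in_itv/= andbT => x0; rewrite gtr0_norm// subrr mul0r.
under eq_integral do rewrite EFinB.
rewrite integralB_EFin//= gamma_abs_mean => /eqP.
have /fineK <- := integrable_fin_num measurableT iX.
by rewrite -EFinB eqe subr_eq0 => /eqP ->.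
Qed.

End Gamma.

(** * Expected utility and acceptable quotes *)

Section Continuity.
Context {R : realType} (m : params R).

Lemma continuous_excess (x : R) : continuous (fun y : R => excess x y%:E).
Proof.
move=> y; under eq_fun do rewrite excess_EFin.
apply: (@continuous_max _ _ (fun y => x - y : R^o)%R (cst (0%R : R^o))).
  by apply: cvgB; [exact: cvg_cst|exact: cvg_id].
exact: cvg_cst.
Qed.

Lemma continuous_utility : continuous (utility m).
Proof.
move=> y; rewrite /utility; apply: cvgM; last exact: cvg_cst.
apply: cvgB; first exact: cvg_cst.
apply: (@continuous_comp _ _ _ (fun y => - (risk m * y))%R expR).
  by apply: cvgN; apply: cvgM; [exact: cvg_cst|exact: cvg_id].
exact: continuous_expR.
Qed.

Lemma cvg_utility_net_value (I : Type) (F : set_system I) (FF : Filter F)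
    (q_ : I -> \bar R) (q : \bar R) (x : R) :
  excess x (q_ k) @[k --> F] --> excess x q ->
  utility m (net_value m (q_ k) x) @[k --> F] --> utility m (net_value m q x).
Proof.
move=> eq_; apply: (@cvg_comp _ _ _ (fun k => net_value m (q_ k) x) (utility m)).
  apply: cvgD; first exact: cvg_cst.
  apply: cvgM; [exact: cvg_cst|exact: eq_].
exact: continuous_utility.
Qed.

End Continuity.

Section JoiningUtility.
Context (d : measure_display) (T : measurableType d) (R : realType)
  (P : probability T R) (X : nat -> {RV P >-> R}) (m : params R).
Hypotheses (hm : admissible_params m) (hX : gamma_waiting X m).
Implicit Types (n k : nat) (q : \bar R).

Let r0 : (0 < risk m)%R. Proof. by case: hm => [[]]. Qed.

Lemma BE n q :
  B X m n q = \int[P]_w (utility m (net_value m q (X n w)))%:E.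
Proof. by rewrite /B unlock. Qed.

Lemma measurable_joining_utility n q : 0 <= q ->
  measurable_fun [set: T] (fun w => utility m (net_value m q (X n w))).
Proof.
move=> q0; apply: measurableT_comp; first exact: measurable_utility.
by apply: measurableT_comp => //; exact: measurable_net_value.
Qed.

Lemma le_B n q q' : 0 <= q -> q <= q' -> B X m n q' <= B X m n q.
Proof.
move=> q0 qq'; rewrite !BE.
apply: (@le_integral_bounded_above _ _ _ P (risk m)^-1).
- exact/measurable_joining_utility/(le_trans q0).
- exact: measurable_joining_utility.
- by move=> w; exact: utility_le_bound.
- by move=> w; apply: utility_homo => //; exact: net_value_le.
Qed.

Lemma B_succ n q : 0 <= q -> B X m n.+1 q <= B X m n q.
Proof.
move=> q0; rewrite !BE.
apply: (@gamma_stochastic_order_le _ _ _ _ _ _ hm hX n (risk m)^-1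
  (fun x => utility m (net_value m q x))).
- apply: measurableT_comp; first exact: measurable_utility.
  exact: measurable_net_value.
- by move=> x; exact: utility_le_bound.
- by move=> x y xy; apply: utility_homo => //; exact: net_value_nonincr.
Qed.

Lemma B_nonincr n k q : 0 <= q -> (n <= k)%N -> B X m k q <= B X m n q.
Proof.
move=> q0; elim: k => [|k IH]; first by rewrite leqn0 => /eqP ->.
rewrite leq_eqVlt ltnS => /predU1P[->//|/IH]; apply: le_trans.
exact: B_succ.
Qed.

(** Upper semicontinuity of the expected utility at level 0, in the quote. *)
Lemma B_ge0_limit n (q_ : nat -> \bar R) q :
  (forall k, 0 <= q_ k) -> 0 <= q ->
  (forall x, excess x (q_ k) @[k --> \oo] --> excess x q) ->
  (forall k, 0 <= B X m n (q_ k)) -> 0 <= B X m n q.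
Proof.
move=> q_0 q0 q_q B0; rewrite BE.
apply: (@integral_ge0_limit _ _ _ P (risk m)^-1
  (fun k w => utility m (net_value m (q_ k) (X n w)))).
- by move=> k; exact: measurable_joining_utility.
- exact: measurable_joining_utility.
- by move=> k w; exact: utility_le_bound.
- by move=> w; exact: utility_le_bound.
- move=> w; apply: cvg_EFin; first exact: nearW.
  by apply: cvg_utility_net_value; exact: q_q.
- by move=> k; rewrite -BE.
Qed.

Lemma B_pinfty_ge0 n :
  (forall k : nat, 0 <= B X m n k%:R%:E) -> 0 <= B X m n +oo.
Proof.
apply: B_ge0_limit => // x.
apply: cvg_near_cst; near=> k.
rewrite excess_EFin excess_pinfty; apply/max_idPr.
rewrite subr_le0; near: k; exact: nbhs_infty_ger.
Unshelve. all: by end_near. Qed.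

Lemma B_left_limit n (y : R) : (0 < y)%R ->
  (forall z : R, (0 <= z < y)%R -> 0 <= B X m n z%:E) -> 0 <= B X m n y%:E.
Proof.
move=> y0 B0; pose z_ k : R := (y - y * k.+1%:R^-1)%R.
have z_y k : (0 <= z_ k < y)%R.
  rewrite /z_ subr_ge0 ltrBlDr ltrDl mulr_gt0// andbT.
  by rewrite ler_piMr ?(ltW y0)// invf_le1// ler1n.
have z_cvg : z_ k @[k --> \oo] --> y.
  rewrite -[X in _ --> X]subr0; apply: cvgB; first exact: cvg_cst.
  rewrite -[X in _ --> X](mulr0 y); apply: cvgM; first exact: cvg_cst.
  exact: cvg_harmonic.
apply: (@B_ge0_limit n (fun k => (z_ k)%:E)) => [k||x|k].
- by rewrite lee_fin; case/andP: (z_y k).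
- by rewrite lee_fin ltW.
- apply: (@cvg_comp _ _ _ z_ (fun y => excess x y%:E) _ _ _ z_cvg).
  exact: continuous_excess.
- exact: B0.
Qed.

(** The limit defining the lower threshold only matters through its sign, so
    upper semicontinuity at level 0 replaces convergence to the expected utility
    without compensation: by monotonicity the limit is an infimum, and
    nonnegativity of all terms passes to the quote [+oo]. *)
Lemma lim_B_lt0 n :
  (lim (B X m n x%:E @[x --> +oo%R]) < 0) <-> (B X m n +oo < 0).
Proof.
(* The quotes are cut off at 0 because monotonicity is only available for
   nonnegative quotes. *)
pose f (x : R) := B X m n (Num.max x 0%R)%:E.
have f_ni : nonincreasing_fun f.
  move=> x y xy; apply: le_B; first by rewrite lee_fin le_max lexx orbT.
  by rewrite lee_fin ge_max !le_max lexx orbT xy.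
have -> : lim (B X m n x%:E @[x --> +oo%R]) = ereal_inf (range f).
  apply/cvg_lim => //; apply: cvg_trans (nonincreasing_cvge f_ni).
  apply: near_eq_cvg; near=> x; rewrite /f; congr (B _ _ _ _%:E).
  by apply/max_idPl; near: x; exact: nbhs_pinfty_ge.
split=> [inf_lt0|B_lt0].
  apply: le_lt_trans inf_lt0; apply: le_ereal_inf_tmp => _ [x _ <-].
  by apply: le_B; rewrite ?leey// lee_fin le_max lexx orbT.
rewrite ltNge; apply/negP => inf_ge0.
move: B_lt0; rewrite ltNge => /negP; apply; apply: B_pinfty_ge0 => k.
apply: (le_trans inf_ge0); apply: ereal_inf_lbound; exists k%:R%R => //.
by rewrite /f; congr (B _ _ _ _%:E); apply/max_idPl.
Unshelve. all: by end_near. Qed.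

(** The acceptable quotes form the whole segment from 0 to the supremum: they are
    downward closed by monotonicity and contain their supremum by upper
    semicontinuity. The conventional value -1 of the supremum of the empty set
    makes the equivalence hold in the degenerate case too. *)
Lemma acceptable_le_dP n q : 0 <= q -> (0 <= B X m n q) = (q <= dP X m n).
Proof.
move=> q0; apply/idP/idP => [Bq|].
  rewrite /dP; case: asboolP => [_|]; last by case; exists q.
  exact: ereal_sup_ubound.
rewrite /dP; case: asboolP => [[q1 [q10 Bq1]]|_]; last first.
  by move/(le_trans q0); rewrite lee_fin oppr_ge0 ler10.
move=> q_sup.
have below z : 0 <= z -> z < q -> 0 <= B X m n z.
  move=> z0 /lt_le_trans/(_ q_sup)/ereal_sup_gt[s [s0 Bs] zs].
  by apply: (le_trans Bs); exact: le_B (ltW zs).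
have [q_pos|] := ltP 0 q; last first.
  by move=> q_le0; apply: (le_trans Bq1); apply: le_B (le_trans q_le0 _).
case: q q0 q_sup below q_pos => [y||//] _ _ below y0.
- apply: B_left_limit => // z /andP[z0 zy].
  by apply: below; rewrite ?lee_fin ?lte_fin.
- by apply: B_pinfty_ge0 => k; apply: below; rewrite ?lee_fin ?ltry.
Qed.

End JoiningUtility.

(** * Welfare of a state *)

Section Welfare.
Context (d : measure_display) (T : measurableType d) (R : realType)
  (P : probability T R) (X : nat -> {RV P >-> R}) (m : params R).
Hypotheses (hm : admissible_params m) (hX : gamma_waiting X m).
Implicit Types (n k : nat) (q : \bar R).

Let c0 : (0 < waiting m)%R. Proof. by case: hm => [[]]. Qed.
Let r0 : (0 < risk m)%R. Proof. by case: hm => [[]]. Qed.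
Let l0 : (0 <= compensation m)%R. Proof. by case: hm => _ [_ /andP[]]. Qed.

(** Net receipts of the firm plus utility of the customer, given the waiting time
    [x]: the quantity whose expectation a social planner maximizes. *)
Definition welfare q (x : R) : R :=
  (fee m - compensation m * excess x q + utility m (net_value m q x))%R.

Lemma welfare_le q (x : R) : (welfare q x <= value m - waiting m * x)%R.
Proof.
have := utility_le_id hm (net_value m q x).
rewrite /welfare /net_value; lra.
Qed.

Lemma welfare_le_bound q (x : R) : 0 <= q ->
  (welfare q x <= fee m + (risk m)^-1)%R.
Proof.
move=> q0; rewrite /welfare lerD ?utility_le_bound//.
by rewrite gerBl mulr_ge0// excess_ge0.
Qed.

Lemma welfare_nonincr q : 0 <= q ->
  {homo welfare q : x y / (x <= y)%R >-> (y <= x)%R}.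
Proof.
move=> q0 x y xy; rewrite /welfare lerD//.
  by rewrite lerD2l lerN2 ler_wpM2l// excess_homo.
by apply: utility_homo => //; exact: net_value_nonincr.
Qed.

(** A customer who has waited [z] has no surplus left. So every compensation paid
    under the quote [z] goes to a customer at a loss, who values it at least at
    its cost, and a later quote only destroys welfare, for every waiting time. *)
Lemma welfare_tail (z : R) q (x : R) : (0 <= z)%R -> z%:E <= q ->
  (value m - fee m <= waiting m * z)%R -> (welfare q x <= welfare z%:E x)%R.
Proof.
move=> z0 zq hz; rewrite /welfare -addrA -[leRHS]addrA lerD2l.
have [xz|/ltW zx] := leP x z.
  suff E q' : z%:E <= q' -> excess x q' = 0%R by rewrite /net_value !E.
  move=> zq'; apply/eqP; rewrite eq_le excess_ge0 ?(le_trans _ zq') ?lee_fin//.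
  rewrite andbT (le_trans (le_excess _ _ zq')) ?lee_fin//.
  by rewrite excess_EFin ge_max lexx subr_le0 xz.
have Ez : excess x z%:E = (x - z)%R.
  by rewrite excess_EFin; apply/max_idPl; rewrite subr_ge0.
have nv_le : (net_value m q x <= net_value m z%:E x)%R.
  by rewrite net_value_le// lee_fin.
have nv0 : (net_value m z%:E x <= 0)%R.
  have lc : (compensation m <= waiting m)%R by case: hm => _ [_ /andP[]].
  have : (compensation m * (x - z) <= waiting m * (x - z))%R.
    by rewrite ler_wpM2r// subr_ge0.
  rewrite /net_value Ez; lra.
have := utility_slope hm nv_le nv0; rewrite /net_value; lra.
Qed.

Lemma measurable_welfare q : 0 <= q -> measurable_fun [set: R] (welfare q).
Proof.
move=> q0; apply: measurable_funD.
  apply: measurable_funB => //; apply: measurable_funM => //.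
  exact: measurable_excess.
apply: (measurableT_comp (measurable_utility m)).
exact: measurable_net_value.
Qed.

Lemma integrable_excess n q : 0 <= q ->
  P.-integrable [set: T] (EFin \o (fun w => excess (X n w) q)).
Proof.
move=> q0; have := integrable_norm (integrable_gamma hm hX n).
apply: le_integrable => //.
  apply/measurable_EFinP.
  by apply: (measurableT_comp (measurable_excess q0)); exact: measurable_funPT.
move=> w _; rewrite /= lee_fin normr_id ger0_norm ?excess_ge0//.
exact: excess_le_norm.
Qed.

Lemma integrable_joining_utility n q : 0 <= q -> 0 <= B X m n q ->
  P.-integrable [set: T] (EFin \o (fun w => utility m (net_value m q (X n w)))).
Proof.
move=> q0; rewrite BE; apply: (@integrable_bounded_above _ _ _ _ (risk m)^-1).
  exact: measurable_joining_utility.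
by move=> w; exact: utility_le_bound.
Qed.

Lemma integrable_fee_net n q : 0 <= q ->
  P.-integrable [set: T]
    (EFin \o (fun w => fee m - compensation m * excess (X n w) q)%R).
Proof.
move=> q0.
rewrite (_ : EFin \o _ = (EFin \o cst (fee m)) \-
    (fun w => (compensation m)%:E * (excess (X n w) q)%:E))//.
apply: integrableB => //; first exact: finite_measure_integrable_cst.
by apply: integrableZl => //; exact: integrable_excess.
Qed.

Lemma integrable_welfare n q : 0 <= q -> 0 <= B X m n q ->
  P.-integrable [set: T] (EFin \o (fun w => welfare q (X n w))).
Proof.
move=> q0 Bq.
rewrite (_ : EFin \o _ =
  (EFin \o (fun w => fee m - compensation m * excess (X n w) q)%R) \+
  (EFin \o (fun w => utility m (net_value m q (X n w)))))//.
apply: integrableD => //; first exact: integrable_fee_net.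
exact: integrable_joining_utility.
Qed.

Lemma GB_welfare n q : 0 <= q -> 0 <= B X m n q ->
  G X m n q + B X m n q = \int[P]_w (welfare q (X n w))%:E.
Proof.
move=> q0 Bq; rewrite /G Bq BE /L unlock /welfare.
under [RHS]eq_integral do rewrite EFinD.
rewrite integralD_EFin//; last 2 first.
- exact: integrable_fee_net.
- exact: integrable_joining_utility.
congr (_ + _).
transitivity (\int[P]_w
    ((fee m)%:E - (compensation m)%:E * (excess (X n w) q)%:E)); last by [].
rewrite integralB//=; last 2 first.
- exact: (@finite_measure_integrable_cst _ _ _ P setT (fee m)).
- by apply: integrableZl => //; exact: integrable_excess.
rewrite integralZl//; last exact: integrable_excess.
by rewrite -[in LHS](expectation_cst P (fee m)) unlock.
Qed.

Lemma GB_fin_num n q : 0 <= q -> 0 <= B X m n q ->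
  G X m n q + B X m n q \is a fin_num.
Proof.
move=> q0 Bq; rewrite GB_welfare//.
exact: (integrable_fin_num measurableT (integrable_welfare q0 Bq)).
Qed.

(** Transfers between firm and customer cancel up to risk aversion, which only
    lowers welfare; what remains is value minus expected waiting cost. *)
Lemma GB_le n q : 0 <= q -> 0 <= B X m n q ->
  G X m n q + B X m n q <= (value m - waiting m * (n.+1%:R / service m))%:E.
Proof.
move=> q0 Bq; rewrite GB_welfare//.
have iX := integrable_gamma hm hX n.
have iV := @finite_measure_integrable_cst _ _ _ P setT (value m) measurableT.
have icX : P.-integrable [set: T] (fun w => (waiting m)%:E * (X n w)%:E).
  exact: integrableZl.
have -> : (value m - waiting m * (n.+1%:R / service m))%:E =
    \int[P]_w ((value m)%:E - (waiting m)%:E * (X n w)%:E).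
  rewrite integralB//= integralZl// (gamma_mean hm hX).
  by rewrite EFinB EFinM -[in LHS](expectation_cst P (value m)) unlock.
apply: le_integral => //; first exact: integrable_welfare.
  exact: integrableB.
by move=> w _; have := welfare_le q (X n w); rewrite -lee_fin EFinB EFinM.
Qed.

(** For a fixed acceptable quote, one more customer ahead raises the expected
    compensation and lowers the expected utility. *)
Lemma GB_succ n q : 0 <= q -> 0 <= B X m n.+1 q ->
  G X m n.+1 q + B X m n.+1 q <= G X m n q + B X m n q.
Proof.
move=> q0 Bq1; have Bq : 0 <= B X m n q by rewrite (le_trans Bq1)// B_succ.
rewrite (GB_welfare q0 Bq1) (GB_welfare q0 Bq).
apply: (@gamma_stochastic_order_le _ _ _ _ _ _ hm hX n (fee m + (risk m)^-1)%R
  (welfare q)).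
- exact: measurable_welfare.
- by move=> x; exact: welfare_le_bound.
- exact: welfare_nonincr.
Qed.

Lemma GB_tail n (z : R) q : (0 <= z)%R -> z%:E <= q ->
  (value m - fee m <= waiting m * z)%R -> 0 <= B X m n q ->
  G X m n q + B X m n q <= G X m n z%:E + B X m n z%:E.
Proof.
move=> z0 zq hz Bq.
have z0E : 0 <= z%:E by rewrite lee_fin.
have Bz : 0 <= B X m n z%:E by rewrite (le_trans Bq)// le_B.
have q0 : 0 <= q by exact: le_trans zq.
rewrite (GB_welfare q0 Bq) (GB_welfare z0E Bz).
apply: le_integral; [exact: measurableT|exact: integrable_welfare
  |exact: integrable_welfare|move=> w _].
by have := welfare_tail (X n w) z0 zq hz; rewrite -lee_fin.
Qed.

End Welfare.

(** * Existence of an optimal quote *)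

Lemma norm_sandwich (R : realType) (p e E u0 u r : R) :
  (0 <= p -> 0 <= r -> 0 <= e <= E -> u0 <= u <= r ->
  `|p - e + u| <= p + E + (r + `|u0|))%R.
Proof.
move=> p0 rge0 /andP[e0 eE] /andP[u0u ur].
have := ler_norm u0; have := ler_norm (- u0); rewrite normrN.
by rewrite ler_norml => *; apply/andP; split; lra.
Qed.

Section Maximizer.
Context (d : measure_display) (T : measurableType d) (R : realType)
  (P : probability T R) (X : nat -> {RV P >-> R}) (m : params R).
Hypotheses (hm : admissible_params m) (hX : gamma_waiting X m).
Implicit Types (n k : nat) (q : \bar R).

Let c0 : (0 < waiting m)%R. Proof. by case: hm => [[]]. Qed.
Let r0 : (0 < risk m)%R. Proof. by case: hm => [[]]. Qed.
Let l0 : (0 <= compensation m)%R. Proof. by case: hm => _ [_ /andP[]]. Qed.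
Let p0 : (0 <= fee m)%R. Proof. by case: hm => _ [/andP[]]. Qed.

Lemma continuous_welfare (x : R) : continuous (fun y : R => welfare m y%:E x).
Proof.
move=> y; apply: cvgD.
  apply: cvgB; first exact: cvg_cst.
  by apply: cvgM; [exact: cvg_cst|exact: continuous_excess].
exact: cvg_utility_net_value (@continuous_excess _ x y).
Qed.

(** Existence of a maximum on a real segment of acceptable quotes, by continuity.
    Dominated convergence applies because the utility at the largest quote [b]
    of the segment is integrable and is the smallest of all. *)
Lemma max_GB_segment n (b : R) : (0 <= b)%R -> b%:E <= dP X m n ->
  exists2 t : R, (0 <= t <= b)%R & forall s : R, (0 <= s <= b)%R ->
    G X m n s%:E + B X m n s%:E <= G X m n t%:E + B X m n t%:E.
Proof.
move=> b0 bdP.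
have b0E : 0 <= b%:E by rewrite lee_fin.
have Bb : 0 <= B X m n b%:E by rewrite (acceptable_le_dP X hm).
(* Clamping extends the objective continuously to all of [R] while keeping
   every quote inside the segment, where the domination holds. *)
pose clamp (t : R) : R := Num.max 0%R (Num.min t b).
have clamp_ge0 t : (0 <= clamp t)%R by rewrite le_max lexx.
have clamp_le t : (clamp t <= b)%R by rewrite ge_max b0 ge_min lexx orbT.
have clampK t : (0 <= t <= b)%R -> clamp t = t.
  by move=> /andP[t0 tb]; rewrite /clamp (min_idPl tb) (max_idPr t0).
have clamp0E t : 0 <= (clamp t)%:E by rewrite lee_fin.
have Bclamp t : 0 <= B X m n (clamp t)%:E.
  have cbE : (clamp t)%:E <= b%:E by rewrite lee_fin.
  exact: le_trans Bb (le_B X hm n (clamp0E t) cbE).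
have cont_clamp : continuous clamp.
  move=> t; apply: (@continuous_max _ _ (cst (0%R : R^o)) (fun t => Num.min t b : R^o)).
    exact: cvg_cst.
  by apply: (@continuous_min _ _ (id : R^o -> R^o) (cst (b : R^o)));
    [exact: cvg_id|exact: cvg_cst].
pose u q w := utility m (net_value m q (X n w)).
pose dom w := (fee m + compensation m * `|X n w| + ((risk m)^-1 + `|u b%:E w|))%R.
have idom : P.-integrable [set: T] (EFin \o dom).
  rewrite (_ : EFin \o dom = ((EFin \o cst (fee m)) \+
     (fun w => (compensation m)%:E * (`|X n w|%R)%:E)) \+
     ((EFin \o cst (risk m)^-1%R) \+ (EFin \o (fun w => `|u b%:E w|%R)))) //.
  apply: integrableD => //; apply: integrableD => //.
  - exact: finite_measure_integrable_cst.
  - apply: integrableZl => //.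
    exact: integrable_norm (integrable_gamma hm hX n).
  - exact: finite_measure_integrable_cst.
  - exact: integrable_norm (integrable_joining_utility hm b0E Bb).
have dom_ub t w : (`|welfare m (clamp t)%:E (X n w)| <= dom w)%R.
  have u_b : (u b%:E w <= u (clamp t)%:E w)%R.
    by apply: utility_homo => //; apply: net_value_le => //; rewrite lee_fin.
  have u_r : (u (clamp t)%:E w <= (risk m)^-1)%R by exact: utility_le_bound.
  have e_bounds : (0 <= compensation m * excess (X n w) (clamp t)%:E <=
      compensation m * `|X n w|)%R.
    by rewrite mulr_ge0 ?excess_ge0//= ler_wpM2l// excess_le_norm.
  apply: (norm_sandwich p0 _ e_bounds); first by rewrite invr_ge0 ltW.
  exact/andP.
pose phi (t : R) := (\int[P]_(w in [set: T]) welfare m (clamp t)%:E (X n w))%R.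
have GBphi t : (0 <= t <= b)%R ->
    G X m n t%:E + B X m n t%:E = (phi t)%:E.
  move=> tb; have Bt := GB_welfare hm hX (clamp0E t) (Bclamp t).
  have fin_t := integrable_fin_num measurableT
    (integrable_welfare hm hX (clamp0E t) (Bclamp t)).
  rewrite /phi /Rintegral fineK; last by exact: fin_t.
  by rewrite -Bt clampK.
have cont_phi : {within `[0%R, b], continuous phi}.
  apply: (@continuous_subspaceW _ _ _ `](-1)%R, (b + 1)%R[).
    by move=> t /=; rewrite !in_itv/= => /andP[t0 tb]; apply/andP; split; lra.
  rewrite continuous_open_subspace//.
  pose F (t : R) w := welfare m (clamp t)%:E (X n w).
  have iF t : `](-1)%R, (b + 1)%R[%classic t ->
      P.-integrable [set: T] (EFin \o F t).
    by move=> _; exact: (integrable_welfare hm hX (clamp0E t) (Bclamp t)).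
  have cF w : continuous (F ^~ w).
    move=> t; apply: (@continuous_comp _ _ _ clamp (fun y => welfare m y%:E (X n w))).
      exact: cont_clamp.
    exact: continuous_welfare.
  have F_ub t : `](-1)%R, (b + 1)%R[%classic t ->
      {ae P, forall w, [set: T] w -> (`|F t w| <= dom w)%R}.
    by move=> _; apply: aeW => w _; exact: dom_ub.
  have cFae : {ae P, forall w, [set: T] w ->
      {in `](-1)%R, (b + 1)%R[%classic, continuous (F ^~ w)}}.
    by apply: aeW => w _ t _; exact: cF.
  have := continuity_under_integral measurableT iF cFae idom F_ub.
  apply.
have [t tb tmax] := EVT_max b0 cont_phi.
exists t => [|s sb]; first by rewrite in_itv/= in tb.
rewrite (GBphi s sb) GBphi; last by rewrite in_itv/= in tb.
by rewrite lee_fin; apply: tmax; rewrite in_itv.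
Qed.

(** The acceptable quotes may be unbounded, but welfare decreases beyond the
    break-even quote [z = (value - fee) / waiting], so the search reduces to a
    compact segment. *)
Lemma exists_dS n : 0 <= B X m n 0 -> exists q, is_dS X m n q.
Proof.
move=> B0.
pose z := ((value m - fee m) / waiting m)%R.
have z0 : (0 <= z)%R.
  by rewrite divr_ge0 ?(ltW c0)// subr_ge0; case: hm => _ [/andP[]].
have hz : (value m - fee m <= waiting m * z)%R.
  by rewrite mulrC divfK// gt_eqF.
have dP0 : 0 <= dP X m n by rewrite -(acceptable_le_dP X hm).
have [b [b0 bdP b_max]] : exists b : R, [/\ (0 <= b)%R, b%:E <= dP X m n &
    forall q, b%:E < q -> q <= dP X m n ->
    G X m n q + B X m n q <= G X m n b%:E + B X m n b%:E].
  have [dPz|/ltW zdP] := leP (dP X m n) z%:E.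
    have dPfin : dP X m n \is a fin_num.
      by rewrite fin_real// (lt_le_trans _ dP0) ?ltNy0// (le_lt_trans dPz) ?ltry.
    exists (fine (dP X m n)); rewrite fineK//; split => //; first exact: fine_ge0.
    by move=> q /lt_le_trans h /h; rewrite ltxx.
  exists z; split => // q zq qdP; apply: (GB_tail hm hX) => //; first exact: ltW.
  rewrite (acceptable_le_dP X hm)//.
  by rewrite (le_trans _ (ltW zq))// lee_fin.
have [t /andP[t0 tb] tmax] := max_GB_segment b0 bdP.
exists t%:E; split.
  by rewrite lee_fin t0/= (le_trans _ bdP)// lee_fin.
move=> q /andP[q0 qdP].
have [qb|bq] := leP q b%:E.
  have q_fin : q \is a fin_num by rewrite ge0_fin_numE// (le_lt_trans qb)// ltry.
  move: q0 qb; rewrite -(fineK q_fin) !lee_fin => s0 sb.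
  by apply: tmax; rewrite s0.
apply: le_trans (b_max _ bq qdP) _; apply: tmax.
by rewrite b0 lexx.
Qed.

End Maximizer.

(** * Choosing the threshold *)

Section Threshold.
Context {R : realType} (rho : R) (f : nat -> R).
Hypothesis rho0 : (0 < rho)%R.

Definition geom (n : nat) : R := (\sum_(k < n.+1) rho ^+ k)%R.
Definition cumul (n : nat) : R := (\sum_(k < n) rho ^+ k * f k)%R.
Definition mean_reward (n : nat) : R := (cumul n / geom n)%R.
(** Up to a positive factor, the change of the mean reward when the balking
    threshold moves from [n] to [n.+1]; it is the sequence defining the stopping
    rule of the theorem, over the reals. *)
Definition marginal (n : nat) : R := (f n * geom n - rho * cumul n)%R.

Let geomS n : geom n.+1 = (geom n + rho ^+ n.+1)%R.
Proof. by rewrite /geom big_ord_recr. Qed.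

Let cumulS n : cumul n.+1 = (cumul n + rho ^+ n * f n)%R.
Proof. by rewrite /cumul big_ord_recr. Qed.

Let geom_ge1 n : (1 <= geom n)%R.
Proof.
rewrite /geom big_ord_recl expr0 lerDl sumr_ge0// => i _.
by rewrite exprn_ge0// ltW.
Qed.

Let geom_gt0 n : (0 < geom n)%R.
Proof. exact: lt_le_trans (geom_ge1 n). Qed.

(** The stationary weights with threshold [n] are proportional to
    [rho ^+ k] for [k <= n], state [n] itself earning nothing; adding one state
    changes the numerator and the denominator by one term each. *)
Lemma mean_reward_step n :
  (mean_reward n.+1 - mean_reward n =
   rho ^+ n * marginal n / (geom n * geom n.+1))%R.
Proof.
have g0 := geom_gt0 n; have g1 := geom_gt0 n.+1.
rewrite /mean_reward /marginal cumulS.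
have -> : (rho ^+ n * (f n * geom n - rho * cumul n) =
  (cumul n + rho ^+ n * f n) * geom n - cumul n * geom n.+1)%R.
  by rewrite geomS exprS; ring.
by field; rewrite !gt_eqF.
Qed.

Lemma mean_reward_le n :
  (mean_reward n <= mean_reward n.+1)%R = (0 <= marginal n)%R.
Proof.
rewrite -subr_ge0 mean_reward_step pmulr_lge0 ?invr_gt0 ?mulr_gt0//.
by rewrite pmulr_rge0// exprn_gt0.
Qed.

Lemma mean_reward_ge n :
  (mean_reward n.+1 <= mean_reward n)%R = (marginal n <= 0)%R.
Proof.
rewrite -subr_le0 mean_reward_step pmulr_lle0 ?invr_gt0 ?mulr_gt0//.
by rewrite pmulr_rle0// exprn_gt0.
Qed.

Lemma marginal_step n :
  (marginal n.+1 - marginal n = geom n.+1 * (f n.+1 - f n))%R.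
Proof. by rewrite /marginal cumulS geomS exprS; ring. Qed.

Lemma marginal_nonincr n : (f n.+1 <= f n)%R -> (marginal n.+1 <= marginal n)%R.
Proof.
by move=> fn; rewrite -subr_le0 marginal_step pmulr_rle0// subr_le0.
Qed.

(** The increments of [marginal] are those of the rewards multiplied by partial
    geometric sums, which are at least 1, and both sequences start at [f 0]. So
    rewards tending to minus infinity drag [marginal] along. *)
Lemma marginal_le_reward n : (forall k, f k.+1 <= f k)%R -> (marginal n <= f n)%R.
Proof.
move=> f_ni; elim: n => [|n IH].
  rewrite /marginal /geom /cumul big_ord0 big_ord_recr big_ord0/=.
  by rewrite expr0 add0r mulr1 mulr0 subr0.
have step := marginal_step n; have g1 := geom_ge1 n.+1; have fn := f_ni n.
have : (geom n.+1 * (f n.+1 - f n) <= f n.+1 - f n)%R.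
  by rewrite ler_neMl// subr_le0.
lra.
Qed.

Lemma mean_reward_below i j : (i <= j)%N ->
  (forall n, (n < j)%N -> 0 <= marginal n)%R -> (mean_reward i <= mean_reward j)%R.
Proof.
elim: j => [|j IH]; first by rewrite leqn0 => /eqP ->.
rewrite leq_eqVlt ltnS => /predU1P[->//|ij] pos.
apply: (le_trans (IH ij _)); first by move=> n nj; apply: pos; exact: ltnW.
by rewrite mean_reward_le pos.
Qed.

Lemma mean_reward_above i j : (i <= j)%N ->
  (forall n, (i <= n < j)%N -> marginal n <= 0)%R -> (mean_reward j <= mean_reward i)%R.
Proof.
elim: j => [|j IH]; first by rewrite leqn0 => /eqP ->.
rewrite leq_eqVlt ltnS => /predU1P[->//|ij] neg.
apply: (@le_trans _ _ (mean_reward j)).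
  by rewrite mean_reward_ge neg// ij/=.
by apply: IH => // n /andP[iLn nj]; apply: neg; rewrite iLn ltnW.
Qed.

End Threshold.

Lemma linear_lt0 (R : realType) (a b : R) : (0 < b)%R ->
  exists n : nat, (a - b * n.+1%:R < 0)%R.
Proof.
move=> b0; exists (Num.truncn (`|a| / b)).
rewrite subr_lt0 mulrC -ltr_pdivrMr//.
apply: le_lt_trans (truncnS_gt _).
by rewrite ler_pM2r ?invr_gt0// ler_norm.
Qed.

(** All three thresholds are infima of sets of naturals embedded in the extended
    reals: either [+oo] or attained. *)
Variant nat_inf_spec (R : realType) (S : set nat) : \bar R -> Prop :=
| NatInfNone of (forall n, ~ S n) : nat_inf_spec S +oo
| NatInfSome n of S n & (forall k, S k -> (n <= k)%N) :
    nat_inf_spec S n%:R%:E.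

Lemma nat_infP (R : realType) (S : set nat) :
  @nat_inf_spec R S (ereal_inf [set n%:R%:E | n in S]).
Proof.
have [[n0 Sn0]|nS] := pselect (exists n, S n); last first.
  rewrite (_ : [set _ | _ in S] = set0) ?ereal_inf0.
    by constructor=> n Sn; apply: nS; exists n.
  by apply/seteqP; split=> // x [n Sn _]; case: nS; exists n.
have exS : exists n, `[< S n >] by exists n0; apply/asboolP.
case: (ex_minnP exS) => n /asboolP Sn n_min.
have n_le k : S k -> (n <= k)%N by move=> Sk; apply: n_min; apply/asboolP.
rewrite (_ : ereal_inf _ = n%:R%:E); first by constructor.
apply/eqP; rewrite eq_le; apply/andP; split.
  by apply: ereal_inf_lbound; exists n.
by apply: le_ereal_inf_tmp => _ [k Sk <-]; rewrite lee_fin ler_nat n_le.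
Qed.

Lemma big_ord_lt_max (R : realType) (n : nat) (F : nat -> \bar R) :
  \sum_(i < n.+1 | (i < n)%N) F i = \sum_(i < n) F i.
Proof.
rewrite big_mkcond big_ord_recr/= ltnn adde0.
by apply: eq_bigr => i _; rewrite ltn_ord.
Qed.

(** * Optimality of the threshold strategy *)

Section Optimality.
Context (d : measure_display) (T : measurableType d) (R : realType)
  (P : probability T R) (X : nat -> {RV P >-> R}) (m : params R).
Hypotheses (hm : admissible_params m) (hX : gamma_waiting X m).
Implicit Types (n k : nat) (q : \bar R).

Let lam0 : (0 < arrival m)%R. Proof. by case: hm => [[]]. Qed.
Let mu0 : (0 < service m)%R. Proof. by case: hm => [[]]. Qed.
Let c0 : (0 < waiting m)%R. Proof. by case: hm => [[]]. Qed.
Let rho := (arrival m / service m)%R.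
Let rho0 : (0 < rho)%R. Proof. by rewrite divr_gt0. Qed.

Let bound_lt0 : exists n : nat,
  (value m - waiting m * (n.+1%:R / service m) < 0)%R.
Proof.
have [|n] := @linear_lt0 R (value m) (waiting m / service m).
  by rewrite divr_gt0.
by move=> h; exists n; rewrite mulrA [X in (_ - X)%R]mulrAC.
Qed.

(** Without compensation welfare is the fee plus the expected utility; were the
    latter nonnegative in all states, welfare could not fall below 0, contrary
    to the linear bound. *)
Lemma exists_unprofitable : exists n, B X m n +oo < 0.
Proof.
have [n n_lt0] := bound_lt0; exists n; rewrite ltNge; apply/negP => Bn.
have Gn : 0 <= G X m n +oo.
  rewrite /G Bn (_ : L X n +oo = 0).
    by rewrite mule0 sube0 lee_fin; case: hm => _ [/andP[]].
  by rewrite /L unlock; under eq_integral do rewrite excess_pinfty; exact: integral0.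
have := le_trans (adde_ge0 Gn Bn) (GB_le hm hX le0y Bn).
by rewrite lee_fin leNgt n_lt0.
Qed.

Lemma n_lowP : exists a : nat, n_low X m = a%:R%:E /\
  forall n, (B X m n +oo < 0) = (a <= n)%N.
Proof.
rewrite /n_low; case: nat_infP => [none|a a_in a_min].
  have [n Bn] := exists_unprofitable; case: (none n) => /=.
  exact/(lim_B_lt0 X hm).
exists a; split=> // n; apply/idP/idP => [Bn|an].
  by apply: a_min; exact/(lim_B_lt0 X hm).
move/(lim_B_lt0 X hm): a_in; apply: le_lt_trans.
exact: (B_nonincr hm hX le0y an).
Qed.

Lemma lt_n_high n : (n%:R%:E < n_high X m) = (0 <= B X m n 0).
Proof.
rewrite /n_high; case: nat_infP => [none|b b_in b_min].
  by rewrite ltry leNgt; apply/esym/negP; exact: none.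
rewrite lte_fin ltr_nat leNgt; apply/idP/idP => [nb|].
  by apply/negP => /b_min; rewrite leqNgt nb.
apply: contraNT; rewrite -leqNgt => bn.
exact: le_lt_trans (B_nonincr hm hX (lexx 0) bn) b_in.
Qed.

Lemma le_n_high n :
  (forall k, (k < n)%N -> 0 <= B X m k 0) -> n%:R%:E <= n_high X m.
Proof.
move=> pos; apply: le_ereal_inf_tmp => _ [k /= Bk <-].
rewrite lee_fin ler_nat leqNgt; apply/negP => /pos.
by rewrite leNgt Bk.
Qed.

Lemma exists_dS_selection : exists dS : nat -> \bar R, dS_selection X m dS.
Proof.
have /choice[dS dSP] : forall n, exists q, n%:R%:E < n_high X m -> is_dS X m n q.
  move=> n; have [nN|nN] := pselect (n%:R%:E < n_high X m); last by exists 0.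
  by move: nN; rewrite lt_n_high => /(exists_dS hm hX)[q hq]; exists q.
by exists dS.
Qed.

Variables (dS : nat -> \bar R) (dSP : dS_selection X m dS).

Let reward n : R := fine (G X m n (dS n) + B X m n (dS n)).

Let dS_opt n : 0 <= B X m n 0 -> is_dS X m n (dS n).
Proof. by rewrite -lt_n_high; exact: dSP. Qed.

Let dS_ge0 n : 0 <= B X m n 0 -> 0 <= dS n.
Proof. by move=> /dS_opt[/andP[]]. Qed.

Lemma dS_acceptable n : 0 <= B X m n 0 -> 0 <= B X m n (dS n).
Proof. by move=> /dS_opt[/andP[q0 qdP] _]; rewrite (acceptable_le_dP X hm). Qed.

Lemma rewardE n : 0 <= B X m n 0 ->
  G X m n (dS n) + B X m n (dS n) = (reward n)%:E.
Proof.
move=> Bn; apply/esym/fineK.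
exact: (GB_fin_num hm hX (dS_ge0 Bn) (dS_acceptable Bn)).
Qed.

Lemma GB_le_reward n q : 0 <= B X m n 0 -> 0 <= q -> 0 <= B X m n q ->
  G X m n q + B X m n q <= (reward n)%:E.
Proof.
move=> Bn q0 Bq; rewrite -(rewardE Bn); have [_ opt] := dS_opt Bn.
by apply: opt; rewrite q0 -(acceptable_le_dP X hm).
Qed.

Lemma B0_pred n : 0 <= B X m n.+1 0 -> 0 <= B X m n 0.
Proof. by move=> Bn; exact: le_trans Bn (B_succ hm hX n (lexx 0)). Qed.

Lemma B0_ge0_le n k : (n <= k)%N -> 0 <= B X m k 0 -> 0 <= B X m n 0.
Proof. by move=> nk Bk; exact: le_trans Bk (B_nonincr hm hX (lexx 0) nk). Qed.

(** A quote that is acceptable in state [n.+1] is acceptable in state [n], where it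
    yields at least as much welfare. *)
Lemma reward_nonincr n : 0 <= B X m n.+1 0 -> (reward n.+1 <= reward n)%R.
Proof.
move=> Bn1; have Bn := B0_pred Bn1.
have q0 := dS_ge0 Bn1; have Bq1 := dS_acceptable Bn1.
have Bq := le_trans Bq1 (B_succ hm hX n q0).
rewrite -lee_fin -(rewardE Bn1).
exact: le_trans (GB_succ hm hX q0 Bq1) (GB_le_reward Bn q0 Bq).
Qed.

Lemma YE n : 0 <= B X m n 0 -> Y X m dS n = (marginal rho reward n)%:E.
Proof.
move=> Bn; rewrite /Y (rewardE Bn) /marginal EFinB EFinM; congr (_ - _).
rewrite EFinM /cumul -sumEFin; congr (_ * _).
apply: eq_bigr => i _; rewrite EFinM.
by rewrite (rewardE (B0_ge0_le (ltnW (ltn_ord i)) Bn)).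
Qed.

Lemma marginal_chain i j : (i <= j)%N -> 0 <= B X m j 0 ->
  (marginal rho reward j <= marginal rho reward i)%R.
Proof.
elim: j => [|j IH]; first by rewrite leqn0 => /eqP ->.
rewrite leq_eqVlt ltnS => /predU1P[->//|ij] Bj.
apply: le_trans (IH ij (B0_pred Bj)).
exact: marginal_nonincr rho0 _ (reward_nonincr Bj).
Qed.

(** When customers can be induced to join in every state (as when compensation
    covers all waiting costs), the stopping rule is still effective: congestion
    makes rewards decrease without bound. *)
Lemma exists_marginal_lt0 : (forall n, 0 <= B X m n 0) ->
  exists n, (marginal rho reward n < 0)%R.
Proof.
move=> pos; have [n n_lt0] := bound_lt0; exists n.
apply: le_lt_trans n_lt0; apply: (@le_trans _ _ (reward n)).
  by apply: (marginal_le_reward rho0) => k; exact: reward_nonincr (pos k.+1).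
rewrite -lee_fin -(rewardE (pos n)).
exact: (GB_le hm hX (dS_ge0 (pos n)) (dS_acceptable (pos n))).
Qed.

(** Since [marginal] is nonincreasing as long as joining can be induced, its first
    negative value separates the states where raising the threshold helps from
    those where it hurts. *)
Lemma stopping_threshold : exists e : nat,
  [/\ mine (n_tilde X m dS) (n_high X m) = e%:R%:E,
      forall n, (n < e)%N -> 0 <= B X m n 0 /\ (0 <= marginal rho reward n)%R &
      forall n, (e <= n)%N -> 0 <= B X m n 0 -> (marginal rho reward n < 0)%R].
Proof.
rewrite /n_tilde; case: nat_infP => [none|t [t_high Yt] t_min].
  have nonneg n : 0 <= B X m n 0 -> (0 <= marginal rho reward n)%R.
    move=> Bn; rewrite leNgt; apply/negP => Yn; apply: (none n); split.
      by rewrite lt_n_high.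
    by rewrite (YE Bn) lte_fin.
  have Bhigh := lt_n_high; move: Bhigh.
  rewrite /n_high; case: nat_infP => [all_pos _|b b_in b_min Bhigh].
    have pos n : 0 <= B X m n 0 by rewrite leNgt; apply/negP; exact: all_pos.
    have [n] := exists_marginal_lt0 pos.
    by rewrite ltNge nonneg.
  exists b; split=> [|n nb|n bn].
  - by apply/min_idPr; rewrite leey.
  - have Bn : 0 <= B X m n 0 by rewrite -Bhigh lte_fin ltr_nat.
    by split; last exact: nonneg.
  - by rewrite -Bhigh lte_fin ltr_nat ltnNge bn.
have Bt : 0 <= B X m t 0 by rewrite -lt_n_high.
have Mt : (marginal rho reward t < 0)%R by rewrite -lte_fin -(YE Bt).
exists t; split=> [|n nt|n tn Bn].
- by apply/min_idPl; exact: ltW.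
- have Bn := B0_ge0_le (ltnW nt) Bt; split; first by [].
  rewrite leNgt; apply/negP => Yn; move: nt; rewrite ltnNge => /negP; apply.
  by apply: t_min; split; rewrite ?lt_n_high// (YE Bn) lte_fin.
- exact: le_lt_trans (marginal_chain tn Bn) Mt.
Qed.

Let q_stat_ge0 n n0 : (0 <= q_stat m n n0)%R.
Proof.
rewrite /q_stat divr_ge0 ?exprn_ge0 ?(ltW rho0)// sumr_ge0// => i _.
by rewrite exprn_ge0 ?(ltW rho0).
Qed.

Let mean_rewardE n0 :
  \sum_(n < n0) (q_stat m n n0)%:E * (reward n)%:E =
  (mean_reward rho reward n0)%:E.
Proof.
rewrite /mean_reward /cumul mulr_suml -sumEFin.
by apply: eq_bigr => i _; rewrite -EFinM /q_stat mulrAC.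
Qed.

(** For a given threshold, the states are decoupled, and each contributes most
    with its own optimal quote. *)
Lemma strategy_benefit_le n0 (D : 'I_n0.+1 -> \bar R) :
  dynamic_strategy X m D ->
  social_benefit X m D <= (arrival m)%:E * (mean_reward rho reward n0)%:E.
Proof.
move=> [/andP[_ n0_high] D0 DB _]; rewrite /social_benefit.
rewrite lee_wpmul2l ?lee_fin ?(ltW lam0)//.
rewrite -mean_rewardE.
rewrite -(big_ord_lt_max n0 (fun n => (q_stat m n n0)%:E * (reward n)%:E)).
apply: lee_sum => i i_lt.
apply: lee_wpmul2l; first by rewrite lee_fin q_stat_ge0.
apply: GB_le_reward; [|exact: D0|exact: DB].
rewrite -lt_n_high; apply: lt_le_trans n0_high.
by rewrite lte_fin ltr_nat.
Qed.

Lemma D_S_benefit nS (eps : R) :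
  social_benefit X m (D_S X m dS (nS := nS) eps) =
  (arrival m)%:E * \sum_(n < nS)
    (q_stat m n nS)%:E * (G X m n (dS n) + B X m n (dS n)).
Proof.
rewrite /social_benefit; congr (_ * _).
rewrite -(big_ord_lt_max nS
  (fun n => (q_stat m n nS)%:E * (G X m n (dS n) + B X m n (dS n)))).
by apply: eq_bigr => i i_lt; rewrite /D_S i_lt.
Qed.

(** At the threshold [nS] the quote exceeds the supremum of the acceptable ones,
    which is finite because nobody joins there without compensation. *)
Lemma D_S_strategy nS (eps : R) :
  (forall n, (n < nS)%N -> 0 <= B X m n 0) -> n_low X m <= nS%:R%:E ->
  B X m nS +oo < 0 -> (0 < eps)%R -> 0 <= dP X m nS + eps%:E ->
  dynamic_strategy X m (D_S X m dS (nS := nS) eps).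
Proof.
move=> pos low BnS eps0 dP_eps; split.
- by rewrite low le_n_high.
- move=> i; rewrite /D_S; case: ifPn => [i_lt|_]; last exact: dP_eps.
  exact: dS_ge0 (pos _ i_lt).
- by move=> i i_lt; rewrite /D_S i_lt; exact: dS_acceptable (pos _ i_lt).
- rewrite /D_S /= ltnn ltNge (acceptable_le_dP X hm _ dP_eps) -ltNge.
  have dP_lty : dP X m nS < +oo.
    by rewrite ltNge -(acceptable_le_dP X hm _ le0y) -ltNge.
  have dP_fin : dP X m nS \is a fin_num.
    rewrite fin_real// dP_lty andbT ltNye; apply/eqP => dPN.
    by move: dP_eps; rewrite dPN.
  by rewrite lteDl// lte_fin.
Qed.

Lemma D_S_social_optimal : exists nS : nat,
  nS%:R%:E = maxe (n_low X m) (mine (n_tilde X m dS) (n_high X m)) /\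
  forall eps : R, (0 < eps)%R -> 0 <= dP X m nS + eps%:E ->
    social_optimal X m (D_S X m dS (nS := nS) eps).
Proof.
have [a [lowE a_spec]] := n_lowP.
have [e [stopE below above]] := stopping_threshold.
have pos n : (n < maxn a e)%N -> 0 <= B X m n 0.
  rewrite leq_max => /orP[na|/below[]//].
  apply: le_trans (le_B X hm n (lexx 0) le0y).
  by rewrite leNgt a_spec -ltnNge.
exists (maxn a e); split.
  by rewrite lowE stopE -EFin_max -natr_max.
move=> eps eps0 dP_eps; split.
  apply: D_S_strategy => //; first by rewrite lowE lee_fin ler_nat leq_maxl.
  by rewrite a_spec leq_maxl.
move=> n1 D1 sD1; apply: le_trans (strategy_benefit_le sD1) _.
rewrite D_S_benefit; under eq_bigr => i _ do rewrite (rewardE (pos _ (ltn_ord i))).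
rewrite mean_rewardE lee_wpmul2l ?lee_fin ?(ltW lam0)//.
case: sD1 => /andP[n1_low n1_high] _ _ _.
have an1 : (a <= n1)%N by move: n1_low; rewrite lowE lee_fin ler_nat.
have [n1S|/ltnW Sn1] := leqP n1 (maxn a e).
  (* If the lower end [a] of the admissible range is the larger bound, then [n1]
     can only be [a] itself. *)
  move: n1S; have [_ n1e|_ n1a] := leqP a e.
    by apply: mean_reward_below => // n /below[].
  by rewrite (_ : n1 = a)//; apply/eqP; rewrite eqn_leq n1a.
apply: mean_reward_above => // n /andP[Sn n_n1].
apply/ltW/above; first by rewrite (leq_trans (leq_maxr _ _) Sn).
by rewrite -lt_n_high; apply: lt_le_trans n1_high; rewrite lte_fin ltr_nat.
Qed.

End Optimality.

Unset Implicit Arguments.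

Theorem theorem3 (d : measure_display) (T : measurableType d) (R : realType)
    (P : probability T R) (X : nat -> {RV P >-> R}) (m : params R)
    (hm : admissible_params m) (hX : gamma_waiting X m) :
  (exists dS : nat -> \bar R, dS_selection X m dS) /\
  (forall dS : nat -> \bar R, dS_selection X m dS ->
    exists nS : nat,
      nS%:R%:E = maxe (n_low X m) (mine (n_tilde X m dS) (n_high X m)) /\
      forall eps : R, (0 < eps)%R -> 0 <= dP X m nS + eps%:E ->
        social_optimal X m (D_S X m dS (nS := nS) eps) /\
        social_benefit X m (D_S X m dS (nS := nS) eps) =
          (arrival m)%:E * \sum_(n < nS)
            (q_stat m n nS)%:E * (G X m n (dS n) + B X m n (dS n))).
Proof.
split=> [|dS dSP]; first exact: exists_dS_selection.
have [nS [nSE opt]] := D_S_social_optimal hm hX dSP.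
exists nS; split=> // eps eps0 dP_eps; split; first exact: opt.
exact: D_S_benefit.
Qed.
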